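(* Let $P(\lambda)=\lambda(J_1+R_1)+(J_2+R_2)\in\mathbb C^{n,n}[\lambda]$, where $J_i^*=-J_i$ and $R_i^*=R_i\ge 0$ for $i=1,2$, be such that $$-(x^*R_1x)(x^*R_2x)+(x^*J_1x)(x^*J_2x)\le 0\quad\text{for all }x\in\mathbb C^n,$$ and at least one of the following two conditions holds: (a) $P(\lambda)$ has no common isotropic vector; (b) $P(\lambda)$ is a regular pencil, and $\mathcal W(\lambda J_1+J_2)$ is contained in the closed left half-plane. Then the numerical range $\mathcal W(P(\lambda))$, and thus all finite eigenvalues of $P(\lambda)$, are contained in the closed left half-plane.
   Context: $M^*$ denotes the conjugate transpose, $M\ge 0$ means Hermitian positive semidefinite. The numerical range of a pencil $L(\lambda)$ is $\mathcal W(L(\lambda))=\{\mu\in\mathbb C : x^*L(\mu)x=0\text{ for some }x\in\mathbb C^n\setminus\{0\}\}$. $P(\lambda)$ has a common isotropic vector if there is a nonzero $x\in\mathbb C^n$ with $x^*(J_1+R_1)x=0=x^*(J_2+R_2)x$. A square pencil is regular if its determinant is not identically zero. *)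

(* Defs.v *)
From mathcomp Require Import all_boot all_order all_algebra.
From mathcomp Require Import spectral fraction complex.
From mathcomp Require Import classical_sets reals.

Set Implicit Arguments.
Unset Strict Implicit.
Unset Printing Implicit Defensive.

Import Order.TTheory GRing.Theory Num.Theory.
Local Open Scope ring_scope.
Local Open Scope sesquilinear_scope.
Local Open Scope classical_set_scope.

Section Pencils.
Variables (C : numClosedFieldType) (n : nat).
Implicit Types (M A B : 'M[C]_n) (x : 'cV[C]_n) (L : 'M[{poly C}]_n).

Definition qform M x : C := (x ^t* *m M *m x) 0 0.

Definition skew_hermitian M : Prop := M ^t* = - M.

(* The order on C is the partial one: 0 <= z means that z is real and
   nonnegative. *)
Definition hermitian_psd M : Prop :=
  M ^t* = M /\ forall x, 0 <= qform M x.

Definition pencil A B : 'M[{poly C}]_n :=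
  'X *: map_mx polyC A + map_mx polyC B.

Definition eval_mx L (mu : C) : 'M[C]_n := map_mx (horner_eval mu) L.

Definition regular_pencil L : Prop := \det L != 0.

Definition numerical_range L : set C :=
  [set mu | exists2 x, x != 0 & qform (eval_mx L mu) x = 0].

Definition has_common_isotropic_vector A B : Prop :=
  exists2 x, x != 0 & qform A x = 0 /\ qform B x = 0.

(* The rank of L over the field of rational functions. *)
Definition normal_rank L : nat := \rank (map_mx (@tofrac {poly C}) L).

(* The rank-drop definition also covers singular pencils; for regular ones it
   gives the roots of the determinant, see finite_eigenvalue_regular. *)
Definition finite_eigenvalue L : set C :=
  [set mu | (\rank (eval_mx L mu) < normal_rank L)%N].

Lemma eval_mx_pencil A B mu : eval_mx (pencil A B) mu = mu *: A + B.
Proof.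
by apply/matrixP => i j; rewrite !mxE /horner_eval !hornerE mulrC.
Qed.

Lemma finite_eigenvalue_regular L mu : regular_pencil L ->
  finite_eigenvalue L mu <-> root (\det L) mu.
Proof.
move=> L_reg; rewrite /finite_eigenvalue /= /normal_rank.
have -> : \rank (map_mx (@tofrac {poly C}) L) = n.
  by apply: mxrank_unit; rewrite unitmxE unitfE det_map_mx tofrac_eq0.
rewrite ltn_neqAle rank_leq_row andbT -[_ == n]/(row_free _) row_free_unit.
by rewrite unitmxE unitfE negbK /eval_mx det_map_mx.
Qed.

End Pencils.

Definition closed_left_half_plane (C : numClosedFieldType) : set C :=
  [set z | 'Re z <= 0].
Arguments closed_left_half_plane {C}.

(* Main.v *)
Require Import Defs.
From mathcomp Require Import all_boot all_order all_algebra.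
From mathcomp Require Import spectral fraction complex.
From mathcomp Require Import classical_sets reals.
From mathcomp Require Import ring.

Import Order.TTheory GRing.Theory Num.Theory.
Local Open Scope ring_scope.
Local Open Scope classical_set_scope.

(** Let [mu] be in the numerical range of the pencil, witnessed by [x].  Then
    [mu * z + w = 0], where [z = p + a] and [w = q + b], the numbers
    [p = x^* R1 x] and [q = x^* R2 x] are nonnegative reals, and
    [a = x^* J1 x] and [b = x^* J2 x] are purely imaginary.  When [z] is
    nonzero, multiplying by the conjugate of [z] and taking real parts gives
    [Re mu * |z|^2 = - p * q + a * b], which is nonpositive by assumption
    ([Re_root_le0]).  When [z] is zero, so is [w], and [x] is a common
    isotropic vector, which contradicts (a).  Moreover [a = b = 0]
    ([real_add_imag_eq0]), so that every complex number, in particular [1],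
    is in the numerical range of the pencil of [J1] and [J2], which
    contradicts (b).

    The finite eigenvalues are covered because they are in the numerical range
    ([finite_eigenvalue_numerical_range]). *)

Section QuadraticForms.
Set Implicit Arguments.
Unset Strict Implicit.
Local Open Scope sesquilinear_scope.
Variables (C : numClosedFieldType) (n : nat).
Implicit Types (M A B : 'M[C]_n) (x : 'cV[C]_n) (L : 'M[{poly C}]_n).

Lemma qformD A B x : qform (A + B) x = qform A x + qform B x.
Proof. by rewrite /qform mulmxDr mulmxDl mxE. Qed.

Lemma qformZ (mu : C) A x : qform (mu *: A) x = mu * qform A x.
Proof. by rewrite /qform -scalemxAr -scalemxAl mxE. Qed.

Lemma qformN A x : qform (- A) x = - qform A x.
Proof. by rewrite -scaleN1r qformZ mulN1r. Qed.

Lemma qform_adjoint M x : qform (M ^t*) x = (qform M x)^*.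
Proof.
have trC_mul m k l (A : 'M[C]_(m, k)) (B : 'M[C]_(k, l)) :
    (A *m B) ^t* = B ^t* *m A ^t* by rewrite trmx_mul map_mxM.
have -> : (qform M x)^* = ((x ^t* *m M *m x) ^t*) 0 0.
  by rewrite [RHS]mxE [in RHS]mxE.
by rewrite !trC_mul trmxCK mulmxA.
Qed.

Lemma qform_skew_conj M x : skew_hermitian M -> (qform M x)^* = - qform M x.
Proof. by move=> hM; rewrite -qform_adjoint hM qformN. Qed.

Lemma mem_numerical_range_pencil A B (mu : C) :
  numerical_range (pencil A B) mu <->
  exists2 x, x != 0 & mu * qform A x + qform B x = 0.
Proof.
rewrite /numerical_range /= eval_mx_pencil.
by split=> -[x x0 hx]; exists x => //; move: hx; rewrite qformD qformZ.
Qed.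

(** The normal rank is at most [n], so a rank drop at [mu] makes [L(mu)]
    singular, and any kernel vector [x] of [L(mu)] satisfies
    [x^* L(mu) x = 0]. *)
Lemma finite_eigenvalue_numerical_range L :
  finite_eigenvalue L `<=` numerical_range L.
Proof.
move=> mu lt_rank.
have : \det (eval_mx L mu) == 0.
  apply: contraTT (leq_trans lt_rank (rank_leq_row _)) => det_neq0.
  by rewrite mxrank_unit ?ltnn // unitmxE unitfE.
rewrite -det_tr => /det0P[v v_neq0 vL].
exists v^T; first by rewrite -(inj_eq (@trmx_inj _ _ _)) trmxK trmx0.
by rewrite /qform -mulmxA -[_ *m v^T]trmxK trmx_mul trmxK vL trmx0 mulmx0 mxE.
Qed.

End QuadraticForms.

Section LinearEquation.
Set Implicit Arguments.
Unset Strict Implicit.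
Variables (C : numClosedFieldType) (p q a b : C).
Hypotheses (p_ge0 : 0 <= p) (q_ge0 : 0 <= q).
Hypotheses (a_imag : a^* = - a) (b_imag : b^* = - b).

Lemma real_add_imag_eq0 : p + a = 0 -> p = 0 /\ a = 0.
Proof.
move=> pa0; have pNa0 : p - a = 0.
  by rewrite -a_imag -(geC0_conj p_ge0) -rmorphD pa0 rmorph0.
have p0 : p = 0.
  apply/eqP; have : p *+ 2 = 0 by rewrite -[RHS]addr0 -{1}pa0 -pNa0; ring.
  by move=> /eqP; rewrite mulrn_eq0.
by move: pa0; rewrite p0 add0r.
Qed.

(** Since [mu = - w / z] with [z = p + a] and [w = q + b], the sign of
    [Re mu] is that of the real part of [- w * conj z], and this real part is
    [- p * q + a * b]. *)
Lemma Re_root_le0 (mu : C) : - (p * q) + a * b <= 0 ->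
  p + a != 0 -> mu * (p + a) + (q + b) = 0 -> 'Re mu <= 0.
Proof.
move=> le0 z_neq0 eq_mu.
have conj_z : (p + a)^* = p - a by rewrite rmorphD /= a_imag geC0_conj.
have eq_conj : mu^* * (p - a) + (q - b) = 0.
  rewrite -conj_z -b_imag -(geC0_conj q_ge0) -rmorphD -rmorphM -rmorphD.
  by rewrite eq_mu rmorph0.
have norm_gt0 : 0 < (p + a) * (p - a).
  by rewrite -conj_z -normCK exprn_gt0 // normr_gt0.
rewrite -(pmulr_lle0 _ norm_gt0).
suff -> : 'Re mu * ((p + a) * (p - a)) = - (p * q) + a * b by [].
have two_neq0 : (2 : C) != 0 by rewrite pnatr_eq0.
have Re2 : 'Re mu * 2 = mu + mu^* by rewrite ReE divfK.
(* Twice the identity is the sum of the equation for [mu] times [p - a] and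
   of its conjugate times [p + a]. *)
apply: (mulIf two_neq0).
rewrite mulrAC Re2; apply/eqP; rewrite -subr_eq0; apply/eqP.
transitivity ((mu * (p + a) + (q + b)) * (p - a)
              + (mu^* * (p - a) + (q - b)) * (p + a)); first by ring.
by rewrite eq_mu eq_conj !mul0r addr0.
Qed.

End LinearEquation.

Theorem theorem5p15 (R : realType) (n : nat) (J1 J2 R1 R2 : 'M[R[i]]_n)
    (hJ1 : skew_hermitian J1) (hJ2 : skew_hermitian J2)
    (hR1 : hermitian_psd R1) (hR2 : hermitian_psd R2)
    (hJR : forall x : 'cV[R[i]]_n,
      - (qform R1 x * qform R2 x) + qform J1 x * qform J2 x <= 0)
    (hab : ~ has_common_isotropic_vector (J1 + R1) (J2 + R2) \/
      (regular_pencil (pencil (J1 + R1) (J2 + R2)) /\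
       numerical_range (pencil J1 J2) `<=` closed_left_half_plane)) :
  numerical_range (pencil (J1 + R1) (J2 + R2)) `<=` closed_left_half_plane /\
  finite_eigenvalue (pencil (J1 + R1) (J2 + R2)) `<=` closed_left_half_plane.
Proof.
suff W_left : numerical_range (pencil (J1 + R1) (J2 + R2))
                `<=` closed_left_half_plane.
  by split=> // mu /finite_eigenvalue_numerical_range /W_left.
move=> mu /mem_numerical_range_pencil[x x_neq0 eq_mu].
have [z0 | z_neq0] := eqVneq (qform (J1 + R1) x) 0; last first.
  rewrite !qformD ![qform J1 x + _]addrC ![qform J2 x + _]addrC in z_neq0 eq_mu.
  exact: (Re_root_le0 (hR1.2 x) (hR2.2 x) (qform_skew_conj x hJ1)
            (qform_skew_conj x hJ2) (hJR x) z_neq0 eq_mu).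
have w0 : qform (J2 + R2) x = 0 by rewrite -eq_mu z0 mulr0 add0r.
case: hab => [no_iso | [_ WJ_left]]; first by case: no_iso; exists x.
rewrite qformD addrC in z0; rewrite qformD addrC in w0.
have [_ a0] := real_add_imag_eq0 (hR1.2 x) (qform_skew_conj x hJ1) z0.
have [_ b0] := real_add_imag_eq0 (hR2.2 x) (qform_skew_conj x hJ2) w0.
(* As [a = b = 0], any number outside the half-plane would do instead of [1]. *)
have : closed_left_half_plane (1 : R[i]).
  apply: WJ_left; apply/mem_numerical_range_pencil.
  by exists x; rewrite // a0 b0 mulr0 addr0.
by rewrite /closed_left_half_plane /= (Creal_ReP _ _) ?rpred1 // ler10.
Qed.
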